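(* For all integers $l\ge 2$ and $n\ge 3$ with $l\le n$, the cover pebbling number of the fuse $F_l(n)$ is $$\gamma(F_l(n))=(n-l+1)2^l-1.$$
   Context: The fuse $F_l(n)$ is the graph with vertices $v_1,\ldots,v_n$ in which the first $l$ vertices form a path $v_1v_2\cdots v_l$ from $v_1$ to $v_l$, and the remaining vertices $v_{l+1},\ldots,v_n$ are pairwise non-adjacent and each is adjacent only to $v_l$. A configuration of pebbles on a graph $G$ assigns a nonnegative integer number of pebbles to each vertex; its size is the total number of pebbles. A pebbling move consists of taking two pebbles off of one vertex (which must have at least two) and placing one pebble on an adjacent vertex. The cover pebbling number $\gamma(G)$ of a finite connected graph $G$ is the minimum number $k$ such that from every initial configuration with $k$ pebbles there is a (possibly empty) sequence of pebbling moves after which every vertex of $G$ simultaneously has at least one pebble on it. *)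

(* Defs.v *)
From mathcomp Require Import all_boot.
From Stdlib Require Import Relation_Operators.

Set Implicit Arguments.
Unset Strict Implicit.
Unset Printing Implicit Defensive.

(* A finite graph is given by a finType of vertices and its adjacency         *)
(* relation [e] (symmetric and irreflexive for a simple graph).               *)
Section CoverPebbling.
Variables (T : finType) (e : rel T).

Definition configuration := {ffun T -> nat}.

Definition config_size (c : configuration) : nat := \sum_(v : T) c v.

(* [u] and [v] are distinct when [e] is irreflexive, so [u] exactly loses two *)
(* pebbles and [v] exactly gains one.                                         *)
Definition move_pebbles (c : configuration) (u v : T) : configuration :=
  [ffun w => c w - 2 * (w == u) + (w == v)].

Definition pebbling_move (c c' : configuration) : Prop :=
  exists u v : T, [/\ e u v, 2 <= c u & c' = move_pebbles c u v].

Definition pebbling_moves : configuration -> configuration -> Prop :=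
  clos_refl_trans configuration pebbling_move.

Definition covers (c : configuration) : Prop := forall v : T, 1 <= c v.

Definition cover_solvable (c : configuration) : Prop :=
  exists2 c' : configuration, pebbling_moves c c' & covers c'.

Definition all_cover_solvable (k : nat) : Prop :=
  forall c : configuration, config_size c = k -> cover_solvable c.

Definition is_cover_pebbling_number (k : nat) : Prop :=
  all_cover_solvable k /\ (forall m : nat, all_cover_solvable m -> k <= m).

End CoverPebbling.

(* The vertex v_(i+1) is represented by [i : 'I_n]. First disjunct: the path  *)
(* edges v_(i+1) v_(i+2) with i + 2 <= l; second: the edges from v_l to each  *)
(* of v_(l+1), ..., v_n.                                                      *)
Definition fuse_arc (l n : nat) : rel 'I_n :=
  fun i j => (i.+1 == j) && (j < l) || (i.+1 == l) && (l <= j).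

Definition fuse (l n : nat) : rel 'I_n :=
  fun i j => fuse_arc l i j || fuse_arc l j i.

Arguments fuse : clear implicits.

Lemma fuse_sym l n : symmetric (fuse l n).
Proof. by move=> i j; rewrite /fuse orbC. Qed.

Lemma fuse_irrefl l n : irreflexive (fuse l n).
Proof.
move=> i; rewrite /fuse orbb /fuse_arc gtn_eqF //=.
by apply/negP => /andP[/eqP <-]; rewrite ltnn.
Qed.

Lemma fuse_connected l n (i j : 'I_n) :
  0 < l -> l <= n -> connect (fuse l n) i j.
Proof.
case: l => // l _ ln; have n_gt0 : 0 < n by exact: leq_trans ln.
pose z := Ordinal n_gt0.
have from0 : forall k : 'I_n, connect (fuse l.+1 n) z k.
  have path0 m (k : 'I_n) : k = m :> nat -> k < l.+1 ->
      connect (fuse l.+1 n) z k.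
    elim: m k => [|m IH] k km kl.
      by rewrite (_ : k = z) ?connect0 //; apply: val_inj.
    have mn : m < n by apply: leq_trans (ltn_ord k); rewrite km.
    apply: (connect_trans (IH (Ordinal mn) _ _)) => //=.
      by apply: leq_trans kl; rewrite km.
    by apply: connect1; rewrite /fuse /fuse_arc /= -km eqxx kl.
  move=> k; case: (ltnP k l.+1) => [|lk]; first exact: path0.
  apply: (connect_trans (path0 l (Ordinal ln) _ _)) => //.
  by apply: connect1; rewrite /fuse /fuse_arc /= eqxx lk orbT.
apply: connect_trans (from0 j).
by rewrite (sym_connect_sym (@fuse_sym _ _)).
Qed.

(* Main.v *)
Require Import Defs.
From mathcomp Require Import all_boot.
From mathcomp Require Import all_order all_algebra zify.
From Stdlib Require Import Relation_Operators.

Set Implicit Arguments.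
Unset Strict Implicit.
Unset Printing Implicit Defensive.

Import GRing.Theory Num.Theory.

(* Lower bound: with all pebbles on v_1, give v the weight 2 ^ dist(v_1, v).  *)
(* A move never increases the weighted size, which is initially the number of *)
(* pebbles and must finally be at least the sum of all the weights.           *)
(* Upper bound: root the tree at v_l and track, at each vertex, the surplus   *)
(* (pebbles minus demand), starting from c - 1. Processing vertices towards   *)
(* the root, a surplus b >= 0 pushes b/2 pebbles to the parent, and a deficit *)
(* b < 0 raises the parent's demand by 2|b|; the configuration is solvable    *)
(* as soon as the surplus reaching the root is nonnegative.                   *)

(** The weights add up to 2^l - 1 on the path plus 2^l for each of the n - l leaves; with
    [weight_moves] this gives the lower bound. For the upper bound, [feasible_push] settles one
    vertex against its parent, so all reduces to the sign of one integer at the root. Its path and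
    leaf parts are bounded below by [path_surplus_ge] and [leaf_carry_ge], and [fuse_surplus_ge0]
    combines the two bounds. *)

Definition carry (z : int) : int :=
  if (0 <= z)%R then (z %/ 2)%Z else (2 * z)%R.

(** * Surpluses on an arbitrary graph *)

Section Surplus.
Variables (T : finType) (e : rel T).

(** Ranging over all [c] and [d] with difference [x] makes the surplus alone matter, so pebbles and
    demands can be adjusted separately. *)
Definition feasible (x : T -> int) : Prop :=
  forall c d : configuration T, (forall v, x v = Posz (c v) - Posz (d v))%R ->
  exists2 c' : configuration T, pebbling_moves e c c' & forall v, d v <= c' v.

Lemma feasible_ge0 (x : T -> int) : (forall v, 0 <= x v)%R -> feasible x.
Proof.
move=> x0 c d xE; exists c; first exact: rt_refl.
by move=> v; have := x0 v; rewrite xE; lia.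
Qed.

Lemma feasible_mono (x y : T -> int) :
  (forall v, x v <= y v)%R -> feasible x -> feasible y.
Proof.
move=> xy fx c d yE.
have [|c' cc' c'd] := fx c [ffun v => d v + `|(y v - x v)%R|%N].
  by move=> v; rewrite ffunE; have := xy v; have := yE v; lia.
by exists c' => // v; have := c'd v; rewrite ffunE; lia.
Qed.

Definition transfer (a b : int) (u p : T) (x : T -> int) : T -> int :=
  fun v => (x v + a *+ (v == u) + b *+ (v == p))%R.

Lemma feasible_forward x u p : e u p -> u != p -> (2 <= x u)%R ->
  feasible (transfer (-2) 1 u p x) -> feasible x.
Proof.
move=> eup up xu fx c d xE.
have cu : 2 <= c u by move: xu; rewrite xE; lia.
have [|c' cc' c'd] := fx (move_pebbles c u p) d.
  move=> v; rewrite ffunE /transfer xE.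
  case: (v =P u) => [->|_]; last by case: eqP => _; lia.
  by rewrite (negbTE up); lia.
exists c' => //; apply: rt_trans cc'.
by apply: rt_step; exists u, p.
Qed.

(** The move from [p] to [u] is made last: the two pebbles added to the demand at [p] supply the one
    removed from the demand at [u]. *)
Lemma feasible_backward x u p : e p u -> u != p -> (x u < 0)%R ->
  feasible (transfer 1 (-2) u p x) -> feasible x.
Proof.
move=> epu up xu fx c d xE.
have du : 0 < d u by move: xu; rewrite xE; lia.
have [|c' cc' c'd] := fx c [ffun v => d v - (v == u) + 2 * (v == p)].
  move=> v; rewrite ffunE /transfer xE.
  case: (v =P u) => [->|_]; last by case: eqP => _; lia.
  by rewrite (negbTE up); lia.
exists (move_pebbles c' p u).
  apply: (rt_trans _ _ _ _ _ cc'); apply: rt_step; exists p, u; split=> //.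
  by have := c'd p; rewrite ffunE eqxx; lia.
move=> v; have := c'd v; rewrite !ffunE.
case: (v =P u) => [->|_]; last by case: eqP => _; lia.
by rewrite (negbTE up); lia.
Qed.

(** Each single transfer brings [x u] closer to 0, and [carry] totals their effect on [p]; a final
    remainder of 1 is discarded. *)
Lemma feasible_push x u p : e u p -> e p u -> u != p ->
  feasible (fun v => if v == u then 0 else x v + carry (x u) *+ (v == p))%R ->
  feasible x.
Proof.
move=> eup epu up; move: {2}`|x u|%N (leqnn `|x u|) => m.
elim: m x => [|m IH] x xm fx.
  apply: feasible_mono fx => v; case: eqP => [->|_]; first lia.
  by rewrite /carry; case: ifP; case: eqP; lia.
have [x2|x2] := lerP 2%R (x u).
  apply: (feasible_forward eup up x2); apply: IH.
    by rewrite /transfer eqxx (negbTE up); lia.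
  apply: feasible_mono fx => v; rewrite /transfer eqxx (negbTE up) /carry.
  by case: (v =P u) => // _; case: (v =P p) => // _; do 2![case: ifP]; lia.
have [x0|x0] := ltrP (x u) 0%R.
  apply: (feasible_backward epu up x0); apply: IH.
    by rewrite /transfer eqxx (negbTE up); lia.
  apply: feasible_mono fx => v; rewrite /transfer eqxx (negbTE up) /carry.
  by case: (v =P u) => // _; case: (v =P p) => // _; do 2![case: ifP]; lia.
apply: feasible_mono fx => v; case: eqP => [->|_]; first lia.
by rewrite /carry; case: ifP; case: eqP; lia.
Qed.

Lemma feasible_cover_solvable (c : configuration T) :
  feasible (fun v => Posz (c v) - 1)%R -> cover_solvable e c.
Proof.
case/(_ c [ffun=> 1]) => [v|c' cc' c'1]; first by rewrite ffunE.
by exists c' => // v; have := c'1 v; rewrite ffunE.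
Qed.

Lemma weight_moves (w : T -> nat) (c c' : configuration T) :
  irreflexive e -> (forall u v, e u v -> w v <= 2 * w u) ->
  pebbling_moves e c c' -> \sum_v c' v * w v <= \sum_v c v * w v.
Proof.
move=> eI ew; elim=> {c c'} [c c' [u [v [euv cu ->]]]| // |c1 c2 c3 _ H1 _ H2].
  have vu : v != u by apply: contraTneq euv => ->; rewrite eI.
  rewrite (bigD1 u) //= (bigD1 v) //= [leqRHS](bigD1 u) //=.
  rewrite [X in _ <= _ + X](bigD1 v) //=.
  rewrite !ffunE !eqxx (negbTE vu) eq_sym (negbTE vu).
  rewrite (eq_bigr (fun t => c t * w t)); last first.
    by move=> t /andP[/negbTE tu /negbTE tv]; rewrite ffunE tu tv; congr (_ * _); lia.
  have := ew _ _ euv; have := leq_mul2r (w u) 2 (c u); rewrite cu orbT.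
  rewrite addn0 addn1 !muln0 subn0 muln1 mulnBl [_.+1 * w v]mulSn.
  by move: (c u * w u) (2 * w u) (c v * w v) (\sum_(_ | _) _); lia.
exact: leq_trans H2 H1.
Qed.

End Surplus.

(** * Arithmetic of the surplus at the root *)

Section PathSurplus.
Variable c : nat -> nat.

Fixpoint path_surplus (i : nat) : int :=
  if i is j.+1 then (Posz (c i) - 1 + carry (path_surplus j))%R
  else (Posz (c 0) - 1)%R.

(* D is the excess over the cover pebbling number 2 ^ i.+1 - 1 of a path with *)
(* i.+1 vertices; the worst case puts all pebbles on the far end when D >= 0, *)
(* but all on the root end when D <= 0. The second bound says that            *)
(* path_surplus i is at least the floor of D / 2 ^ i.                         *)
Lemma path_surplus_ge i (D := (Posz (\sum_(0 <= t < i.+1) c t) - 2 ^+ i.+1 + 1)%R) :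
  ((D <= 0 -> D <= path_surplus i) /\
   (0 <= D -> D < 2 ^+ i * (path_surplus i + 1)))%R.
Proof.
rewrite {}/D; elim: i => [|i IH]; first by rewrite big_nat1 /=; lia.
rewrite big_nat_recr //= exprS; move: IH; rewrite exprS.
move: (path_surplus i) (c i.+1) (\sum_(0 <= i0 < i.+1) c i0) => b a P.
have: (1 <= 2 ^+ i :> int)%R by rewrite -natrX; lia.
move: (2 ^+ i)%R => M M1 [H1 H2]; rewrite PoszD /carry.
case: ifP => b0; last by split; nia.
have [qb q0] : (b <= 2 * (b %/ 2)%Z + 1 /\ 0 <= (b %/ 2)%Z)%R by lia.
move: (b %/ 2)%Z qb q0 => q qb q0.
(* This is [b + 1 <= 2 * (q + 1)] scaled by [M]: the strict bound absorbs the rounding while the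
   power of 2 doubles. *)
have MP : (M * b <= M * (2 * q + 1))%R by nia.
case: (lerP 0%R (Posz P - 2 * M + 1)%R) => D0; split; nia.
Qed.

Definition leaf_carry (m k : nat) : int :=
  (\sum_(m <= t < m + k) carry (Posz (c t) - 1))%R.

(** Twice the carry of a leaf with [a] pebbles is [-4] if [a = 0] and at least [a - 2] otherwise, so
    a single nonempty leaf already gains the extra 2. *)
Lemma leaf_carry_ge m k (S := \sum_(m <= t < m + k) c t) :
  (Posz S - 4 * Posz k <= 2 * leaf_carry m k)%R /\
  (0 < S -> (Posz S - 4 * Posz k + 2 <= 2 * leaf_carry m k)%R).
Proof.
rewrite {}/S /leaf_carry; elim: k => [|k [H1 H2]].
  by rewrite addn0 !big_geq.
rewrite addnS !big_nat_recr ?leq_addr //=; move: H1 H2.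
move: (\sum_(m <= t < m + k) carry (Posz (c t) - 1))%R => L.
move: (\sum_(m <= i < m + k) c i) (c (m + k)) => S a.
by rewrite /carry; case: ifP; case: (posnP S); lia.
Qed.

Lemma fuse_surplus_ge0 l k : 2 <= l ->
  \sum_(0 <= t < l + k) c t = (k + 1) * 2 ^ l - 1 ->
  (0 <= path_surplus l.-1 + leaf_carry l k)%R.
Proof.
case: l => [|[|l]] // _; rewrite (big_cat_nat _ (n := l.+2)) ?leq_addr //=.
rewrite -[(_ + carry _)%R]/(path_surplus l.+1).
have : 0 < \sum_(l.+2 <= t < l.+2 + k) c t -> 0 < k.
  by case: k => //; rewrite addn0 big_geq.
have [] := path_surplus_ge l.+1; have [] := leaf_carry_ge l.+2 k.
move: (path_surplus _) (leaf_carry _ _) => b L.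
move: (\sum_(0 <= t < l.+2) c t) (\sum_(l.+2 <= t < l.+2 + k) c t) => P S.
have : 1 <= 2 ^ l by lia.
have -> : (2 ^+ l.+2 = 4 * Posz (2 ^ l) :> int)%R by rewrite !exprS -natrX; lia.
have -> : (2 ^+ l.+1 = 2 * Posz (2 ^ l) :> int)%R by rewrite !exprS -natrX; lia.
rewrite !expnS; move: (2 ^ l) => M M1 L1 L2 H1 H2 Sk E.
have EZ : (Posz P + Posz S = (Posz k + 1) * (4 * Posz M) - 1)%R by nia.
case: (lerP (Posz P - 4 * Posz M + 1)%R 0%R) => D0; last first.
  (* The two bounds add up to more than [(M - 1) * S >= 0]; here [4 * M] is the weight of a leaf. *)
  suff: (0 < 2 * Posz M * (b + L + 1))%R by nia.
  have := H2 (Order.POrderTheory.ltW D0); nia.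
(* If [S = 0] then [k = 0]. Otherwise [k > 0] and [2 * (b + L) >= 4 * (M - 1) * (k - 1) - 1 >= -1],
   so parity gives the claim. *)
have := H1 D0. have [S0|S0] := posnP S; first nia.
have := L2 S0; have := Sk S0; nia.
Qed.

End PathSurplus.

(** * Processing the fuse towards [v_l] *)

Section Fuse.
Variables (l n : nat).
Hypotheses (l_gt0 : 0 < l) (le_ln : l <= n.+1).
Variable c : nat -> nat.

(* The surpluses once v_1, ..., v_i have been processed. *)
Let path_state i (v : 'I_n.+1) : int :=
  if v < i then 0%R else if v == i :> nat then path_surplus c i
  else (Posz (c v) - 1)%R.

Lemma feasible_path_state i : i < l -> feasible (fuse l n.+1) (path_state i) ->
  feasible (fuse l n.+1) (fun v => Posz (c v) - 1)%R.
Proof.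
elim: i => [|i IH] il fi.
  by apply: feasible_mono fi => v; rewrite /path_state /=; case: eqP => // ->.
have vi : (inord i : 'I_n.+1) = i :> nat by rewrite inordK //; lia.
have vi1 : (inord i.+1 : 'I_n.+1) = i.+1 :> nat by rewrite inordK //; lia.
apply: IH; first lia.
apply: (@feasible_push _ _ _ (inord i) (inord i.+1)).
- by rewrite /fuse /fuse_arc vi vi1 eqxx il.
- by rewrite /fuse /fuse_arc vi vi1 eqxx il orbT.
- by rewrite -val_eqE /= vi vi1; lia.
apply: feasible_mono fi => v; rewrite /path_state -!val_eqE /= vi vi1 ltnn eqxx.
case: (v =P i :> nat) => [->|vni]; first by rewrite leqnn.
case: (v =P i.+1 :> nat) => [->|vni1]; first by rewrite /= !ifN; lia.
by rewrite mulr0n addr0; case: (ltnP v i.+1); case: (ltnP v i); lia.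
Qed.

(* The surpluses once the path and the first k leaves have been processed. *)
Let leaf_state k (v : 'I_n.+1) : int :=
  if v < l.-1 then 0%R
  else if v == l.-1 :> nat then (path_surplus c l.-1 + leaf_carry c l k)%R
  else if v < l + k then 0%R else (Posz (c v) - 1)%R.

Lemma feasible_leaf_state k : l + k <= n.+1 ->
  feasible (fuse l n.+1) (leaf_state k) ->
  feasible (fuse l n.+1) (fun v => Posz (c v) - 1)%R.
Proof.
elim: k => [|k IH] lk fk.
  apply: (@feasible_path_state l.-1); first lia.
  apply: feasible_mono fk => v; rewrite /leaf_state /path_state.
  rewrite /leaf_carry addn0 big_geq // addr0.
  by case: (ltnP v l.-1) => // vl; case: eqP => // vl'; rewrite ifN //; lia.
have vu : (inord (l + k) : 'I_n.+1) = l + k :> nat by rewrite inordK //; lia.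
have vp : (inord l.-1 : 'I_n.+1) = l.-1 :> nat by rewrite inordK //; lia.
apply: IH; first lia.
apply: (@feasible_push _ _ _ (inord (l + k)) (inord l.-1)).
- by rewrite /fuse /fuse_arc vu vp prednK // eqxx leq_addr /= !orbT.
- by rewrite /fuse /fuse_arc vu vp prednK // eqxx leq_addr /= !orbT.
- by rewrite -val_eqE /= vu vp; lia.
apply: feasible_mono fk => v; rewrite /leaf_state -!val_eqE /= vu vp.
have /negbTE -> : ~~ (l + k < l.-1) by lia.
have /negbTE -> : l + k != l.-1 by lia.
rewrite ltnn.
case: (v =P l + k :> nat) => [->|vu']; first by rewrite /= 2?ifN ?ifT //; lia.
case: (v =P l.-1 :> nat) => [->|vp'].
  by rewrite ltnn /leaf_carry addnS big_nat_recr ?leq_addr //= addrA.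
rewrite mulr0n addr0; case: ifP => // _; rewrite addnS ltnS leq_eqVlt.
by case: (v =P l + k :> nat).
Qed.

End Fuse.

Lemma fuse_all_cover_solvable l n : 2 <= l -> l <= n ->
  all_cover_solvable (fuse l n) ((n - l + 1) * 2 ^ l - 1).
Proof.
case: n => [|n] l2 ln; first lia.
move=> c csize; pose g i := c (inord i).
have gsum : \sum_(0 <= t < l + (n.+1 - l)) g t = (n.+1 - l + 1) * 2 ^ l - 1.
  rewrite subnKC // -csize /config_size big_mkord.
  by apply: eq_bigr => i _; rewrite /g inord_val.
apply: feasible_cover_solvable.
apply: (@feasible_mono _ _ (fun v : 'I_n.+1 => Posz (g v) - 1)%R).
  by move=> v; rewrite /g inord_val.
apply: (@feasible_leaf_state l n _ _ g (n.+1 - l)); try lia.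
apply: feasible_ge0 => v; case: ifP => // _; case: ifP => _.
  exact: fuse_surplus_ge0.
by rewrite ifT // subnKC.
Qed.

Lemma fuse_cover_lower_bound l n m : 0 < l -> l <= n ->
  all_cover_solvable (fuse l n) m -> (n - l + 1) * 2 ^ l - 1 <= m.
Proof.
case: n => [|n] l0 ln; first lia.
(* [minn v l] is the distance from [v_1], since every leaf lies at distance [l]. *)
pose w (v : 'I_n.+1) := 2 ^ minn v l.
move=> /(_ [ffun v => m * (v == ord0)]) [|c' cc' c'1].
  rewrite /config_size (bigD1 ord0) //= big1 ?ffunE ?eqxx; first lia.
  by move=> v /negbTE v0; rewrite ffunE v0 muln0.
have wE u v : fuse l n.+1 u v -> w v <= 2 * w u.
  rewrite /fuse /fuse_arc /w -expnS => uv; rewrite leq_exp2l //; lia.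
have := weight_moves (@fuse_irrefl l n.+1) wE cc'.
rewrite [leqRHS](bigD1 ord0) //= [in leqRHS]big1 ?ffunE ?eqxx; last first.
  by move=> v /negbTE v0; rewrite ffunE v0 muln0.
rewrite /w min0n expn0 !muln1 addn0; apply: leq_trans.
apply: (@leq_trans (\sum_(v < n.+1) 2 ^ minn v l)); last first.
  by apply: leq_sum => v _; rewrite leq_pmull.
rewrite -(big_mkord xpredT (fun i => 2 ^ minn i l)) (big_cat_nat _ (n := l)) //=.
rewrite (eq_big_nat _ _ (F2 := fun i => 2 ^ i)); last first.
  by move=> i /andP[_ il]; congr (2 ^ _); lia.
rewrite [X in _ <= _ + X](eq_big_nat _ _ (F2 := fun i => 2 ^ l)); last first.
  by move=> i /andP[il _]; congr (2 ^ _); lia.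
rewrite sum_nat_const_nat big_mkord.
have := predn_exp 2 l; rewrite mul1n => <-.
by have := expn_gt0 2 l; nia.
Qed.

Theorem theorem4 (l n : nat) (hl : 2 <= l) (hn : 3 <= n) (hln : l <= n) :
  is_cover_pebbling_number (fuse l n) ((n - l + 1) * 2 ^ l - 1).
Proof.
split; first exact: fuse_all_cover_solvable.
by move=> m; apply: fuse_cover_lower_bound => //; exact: ltnW.
Qed.
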